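(* Let $X$ be a connected topological space admitting a universal covering space $\widetilde{X}$ and let $\zeta$ be a group covering on $X$. Denote by $\Gamma$ the typical fibre of $\zeta$ and choose a group morphism $\varphi : \pi_1X\to\mathrm{Aut}(\Gamma)$ which represents $\zeta$, i.e. such that $\zeta\simeq\pi_1X\backslash(\widetilde{X}\times\Gamma)$ as group coverings, where $f\in\pi_1X$ acts on $\widetilde{X}\times\Gamma$ by $\tau_f(\xi,\gamma) := (f(\xi),\varphi_f(\gamma))$. Let $\eta$ be a $\zeta$-torsor. Then there exist a crossed morphism $\rho : \pi_1X\to\Gamma$, i.e. a map satisfying $\rho(f_1\circ f_2) = \rho(f_1)\,\varphi_{f_1}(\rho(f_2))$ for all $f_1,f_2\in\pi_1X$, and an isomorphism of $\zeta$-torsors $$\eta\simeq\pi_1X\,\backslash\,(\widetilde{X}\times\Gamma),$$ where $f\in\pi_1X$ acts to the left on $(\xi,\gamma)\in\widetilde{X}\times\Gamma$ via $\sigma_f(\xi,\gamma) := (f(\xi),\rho(f)\varphi_f(\gamma))$. Moreover, if $\rho$ and $\rho'$ are crossed morphisms from $\pi_1X$ to $\Gamma$, then the associated $\zeta$-torsors $\eta$ and $\eta'$ are isomorphic over $X$ if and only if $\rho$ and $\rho'$ are conjugate under the action of $\Gamma$ on the set $Z^1_\varphi(\pi_1X,\Gamma)$ of crossed morphisms defined, for all $\gamma\in\Gamma$ and all $f\in\pi_1X$, by $(\gamma\bullet\rho)(f) := \gamma\,\rho(f)\,\varphi_f(\gamma^{-1})$. So the set of isomorphism classes of $\zeta$-torsors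 on $X$ is in bijection with the group cohomology set $$H^1_\varphi(\pi_1X,\Gamma) := \Gamma\,\backslash\,Z^1_\varphi(\pi_1X,\Gamma).$$
   Context: A group covering on a topological space $X$ is a topological space $\zeta$ with a continuous map $p : \zeta\to X$ whose fibres are discrete groups, such that every $x\in X$ has an open neighbourhood $U$ with a homeomorphism $p^{-1}(U)\simeq U\times p^{-1}(x)$ over $U$ that is a group isomorphism on each fibre. Isomorphisms of group coverings are homeomorphisms over $X$ that are group isomorphisms fibrewise. The universal covering $\widetilde{X}\to X$ is simply connected (and connected), and $\pi_1X$ is identified with its automorphism group $\mathrm{Aut}_X(\widetilde{X})$, acting on $\widetilde{X}$ to the left; $\varphi_f$ denotes the image of $f$ under $\varphi$. (A morphism $\varphi$ representing $\zeta$ always exists.) A (right) $\zeta$-torsor is a topological space $\eta$ over $X$ with a continuous map $\eta\times_X\zeta\to\eta$ over $X$ that is fibrewise a right group action, such that every point of $X$ has an open neighbourhood $U$ with a $\zeta|_U$-equivariant homeomorphism $\zeta|_U\simeq\eta|_U$ over $U$ ($\zeta|_U$ acting on itself by right translations). Morphisms of $\zeta$-torsors are equivariant continuous maps over $X$. The $\zeta$-torsor structure on the quotient of $\widetilde{X}\times\Gamma$ by the action $\sigma$ is given by $[\xi,\gamma]\cdot[\xi,\delta] := [\xi,\gamma\delta]$, where $[\xi,\delta]$ is the class in $\zeta\simeq\pi_1X\backslash(\widetilde{X}\times\Gamma)$ (quotient via $\tau$).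
   Formalization: ''Simply connected'' for the universal covering is taken in the covering sense: nonempty, connected, and every covering of it is trivial. With the usual loop-based meaning and no local path-connectedness the claim fails (Warsaw circle with its nontrivial double cover). *)

(* Defs.v *)
From HB Require Import structures.
From mathcomp Require Import all_boot all_order all_algebra.
From mathcomp Require Import all_classical topology.

Set Implicit Arguments.
Unset Strict Implicit.
Unset Printing Implicit Defensive.

Local Open Scope classical_set_scope.
Local Open Scope quotient_scope.
Local Open Scope group_scope.

#[local] Obligation Tactic := idtac.

Section Actions.

Record left_action (G : groupType) (T : Type) := LeftAction {
  lact :> G -> T -> T;
  lact1 : forall x, lact 1 x = x;
  lactM : forall g h x, lact (g * h) x = lact g (lact h x)
}.

Context (G : groupType) (T : choiceType) (a : left_action G T).

Definition orbit_rel (x y : T) := `[< exists g, y = a g x >].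

Lemma orbit_rel_refl : reflexive orbit_rel.
Proof. by move=> x; apply/asboolP; exists 1; rewrite lact1. Qed.

Lemma orbit_rel_sym : symmetric orbit_rel.
Proof.
have H x y : orbit_rel x y -> orbit_rel y x.
  move=> /asboolP[g ->]; apply/asboolP; exists g^-1.
  by rewrite -lactM mulVg lact1.
by move=> x y; apply/idP/idP; exact: H.
Qed.

Lemma orbit_rel_trans : transitive orbit_rel.
Proof.
move=> y x z /asboolP[g ->] /asboolP[h ->]; apply/asboolP; exists (h * g).
by rewrite lactM.
Qed.

Definition orbit_equiv :=
  EquivRel orbit_rel orbit_rel_refl orbit_rel_sym orbit_rel_trans.

Definition orbits := {eq_quot orbit_equiv}.
HB.instance Definition _ := Choice.on orbits.
HB.instance Definition _ := Quotient.on orbits.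

Definition orbit_of (x : T) : orbits := \pi_orbits x.

Lemma orbit_ofP x y : orbit_of x = orbit_of y <-> exists g, y = a g x.
Proof. by split=> [/eqmodP/asboolP|?]; last exact/eqmodP/asboolP. Qed.

Lemma orbit_ofW q : exists x, q = orbit_of x.
Proof. by exists (repr q); rewrite /orbit_of reprK. Qed.

End Actions.

Section OrbitSpace.
Context (G : groupType) (T : topologicalType) (a : left_action G T).

Definition orbit_space := orbits a.
HB.instance Definition _ := Quotient.on orbit_space.
HB.instance Definition _ :=
  Topological.copy orbit_space (quotient_topology (orbits a)).

Definition orbit_class : T -> orbit_space := orbit_of a.

End OrbitSpace.

Section Coverings.

Definition homeomorphism (S T : topologicalType) (f : S -> T) :=
  continuous f /\ exists g, [/\ continuous g, cancel f g & cancel g f].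

Definition discrete_space (T : topologicalType) := forall A : set T, open A.

Definition fibre (E X : Type) (p : E -> X) (x : X) : set E := p @^-1` [set x].

Context (E X : topologicalType) (p : E -> X).

Definition trivialization (x : X) (U : set X)
    (h : p @^-1` U -> (U * fibre p x)%type) :=
  homeomorphism h /\ forall e, set_val (h e).1 = p (set_val e).

Definition covering :=
  [/\ continuous p,
      forall x, discrete_space (fibre p x)
    & forall x, exists2 U, open_nbhs x U &
        exists h : p @^-1` U -> (U * fibre p x)%type, trivialization h].

Definition trivial_covering :=
  exists (F : discreteTopologicalType) (h : E -> (X * F)%type),
    homeomorphism h /\ forall e, (h e).1 = p e.

End Coverings.

Lemma covering_sheets (E X : topologicalType) (p : E -> X) (e : E) :
  covering p -> exists2 U, open_nbhs (p e) U & exists V : fibre p (p e) -> set E,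
   [/\ forall c, open (V c),
       forall a, U (p a) -> exists c, V c a,
       forall c c' a, V c a -> V c' a -> c = c'
     & forall c a b, V c a -> V c b -> p a = p b -> a = b].
Proof.
case=> cp dp /(_ (p e))[U oU [h [[ch [k [ck hk kh]]] hp]]]; exists U => //.
exists (fun c => [set a | exists2 z, set_val z = a & (h z).2 = c]); split.
- move=> c; have oc : open [set z | (h z).2 = c].
    have cs : continuous (fun z => (h z).2).
      by move=> z; apply: continuous_comp; [exact: ch|exact: cvg_snd].
    have := dp (p e) [set c].
    by move/continuousP: cs => /[apply].
  case: oc => W oW WE.
  rewrite (_ : [set _ | _] = W `&` p @^-1` U).
    apply: openI => //; move/continuousP: cp; apply; exact: oU.1.
  rewrite eqEsubset; split => a /=.
    case=> z <- hz; split; first by rewrite -[W _]/((set_val @^-1` W) z) WE.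
    exact: set_mem (valP z).
  case=> Wa Ua; pose z : p @^-1` U := exist _ a (mem_set Ua).
  by exists z => //; rewrite -[_ = c]/([set z | (h z).2 = c] z) -WE.
- by move=> a Ua; exists (h (exist _ a (mem_set Ua))).2, (exist _ a (mem_set Ua)).
- move=> c c' a [z za <-] [z' za' <-]; congr (h _).2.
  by apply: val_inj => /=; rewrite -!set_valE za za'.
- move=> c _ _ [z <- hz] [z' <- hz'] pe; congr set_val.
  apply: (can_inj hk); have := hp z; have := hp z'; move: hz hz'.
  case: (h z) => u v; case: (h z') => u' v' /= -> -> E1 E2; congr pair.
  by apply: val_inj; rewrite -set_valE E1 E2.
Qed.

Lemma unique_lift (Y E X : topologicalType) (p : E -> X) (f g : Y -> E) :
  covering p -> connected [set: Y] -> continuous f -> continuous g ->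
  p \o f =1 p \o g -> (exists y, f y = g y) -> f =1 g.
Proof.
move=> cp cY cf cg fg [y0 fy0].
pose A := [set y | f y = g y].
have nbA y : f y = g y -> \forall z \near y, f z = g z.
  move=> fgy; have [U [oU Uy] [V [oV VU _ Vinj]]] := covering_sheets (f y) cp.
  have [c Vc] := VU _ Uy.
  have nf : \forall z \near y, V c (f z) by apply: cf; exact: open_nbhs_nbhs.
  have ng : \forall z \near y, V c (g z).
    by apply: cg; apply: open_nbhs_nbhs; split => //; rewrite -fgy.
  by apply: filterS2 nf ng => z Vf Vg; apply: Vinj Vf Vg (fg z).
have nbC y : f y <> g y -> \forall z \near y, f z <> g z.
  move=> fgy; have [U [oU Uy] [V [oV VU Vd Vinj]]] := covering_sheets (f y) cp.
  have [c Vc] := VU _ Uy; have := fg y => /= pfg.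
  have [c' Vc'] : exists c', V c' (g y) by apply: VU; rewrite -pfg.
  have nf : \forall z \near y, V c (f z) by apply: cf; exact: open_nbhs_nbhs.
  have ng : \forall z \near y, V c' (g z) by apply: cg; exact: open_nbhs_nbhs.
  apply: filterS2 nf ng => z Vf Vg fgz; apply: fgy.
  have cc : c = c' by apply: Vd Vf _; rewrite fgz.
  by apply: Vinj Vc _ pfg; rewrite cc.
have : A = setT.
  apply: cY; first by exists y0.
    exists A; last by rewrite setTI.
    by rewrite openE => y; exact: nbA.
  exists A; last by rewrite setTI.
  by rewrite -[A]setCK; apply: open_closedC; rewrite openE => y; exact: nbC.
by move=> AT y; have : setT y by []; rewrite -AT.
Qed.

(* Simple connectedness in the sense of covering theory.  On spaces that are
   not locally path connected the vanishing of the path-based fundamental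
   group does not make coverings trivial (the Warsaw circle has a nontrivial
   double covering). *)
Definition simply_connected (Y : topologicalType) :=
  [/\ [set: Y] !=set0, connected [set: Y]
    & forall (E : topologicalType) (q : E -> Y),
        covering q -> trivial_covering q].

Definition universal_covering (Xt X : topologicalType) (p : Xt -> X) :=
  covering p /\ simply_connected Xt.

Section Deck.
Context (Xt X : topologicalType) (p : Xt -> X).

Record deck := Deck {
  deck_fun :> Xt -> Xt;
  deck_inv : Xt -> Xt;
  deck_funK : cancel deck_fun deck_inv;
  deck_invK : cancel deck_inv deck_fun;
  deck_fun_continuous : continuous deck_fun;
  deck_inv_continuous : continuous deck_inv;
  deck_over : forall e, p (deck_fun e) = p e
}.

Lemma deckP (f g : deck) : f =1 g -> f = g.
Proof.
case: f g => [f f' fK f'K cf cf' pf] [g g' gK g'K cg cg' pg] /= /funext fg.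
subst g; have E : f' = g' by apply/funext => e; rewrite -{1}(g'K e) fK.
by subst g'; congr Deck; exact: Prop_irrelevance.
Qed.

HB.instance Definition _ := gen_eqMixin deck.
HB.instance Definition _ := gen_choiceMixin deck.

Definition deck_one : deck :=
  @Deck id id (fun=> erefl) (fun=> erefl) (fun=> cvg_id) (fun=> cvg_id) (fun=> erefl).

Program Definition deck_mul (f g : deck) :=
  @Deck (fun e => f (g e)) (fun e => deck_inv g (deck_inv f e)) _ _ _ _ _.
Next Obligation. by move=> f g e /=; rewrite !deck_funK. Qed.
Next Obligation. by move=> f g e /=; rewrite !deck_invK. Qed.
Next Obligation.
by move=> f g x; apply: continuous_comp; exact: deck_fun_continuous.
Qed.
Next Obligation.
by move=> f g x; apply: continuous_comp; exact: deck_inv_continuous.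
Qed.
Next Obligation. by move=> f g e; rewrite !deck_over. Qed.

Program Definition deck_invg (f : deck) :=
  @Deck (deck_inv f) f _ _ _ _ _.
Next Obligation. by move=> f; exact: deck_invK. Qed.
Next Obligation. by move=> f; exact: deck_funK. Qed.
Next Obligation. by move=> f; exact: deck_inv_continuous. Qed.
Next Obligation. by move=> f; exact: deck_fun_continuous. Qed.
Next Obligation. by move=> f e; rewrite -[in RHS](deck_invK f e) deck_over. Qed.

Fact deck_mulA : associative deck_mul.
Proof. by move=> f g h; exact: deckP. Qed.
Fact deck_mul1 : left_id deck_one deck_mul.
Proof. by move=> f; exact: deckP. Qed.
Fact deck_mulr1 : right_id deck_one deck_mul.
Proof. by move=> f; exact: deckP. Qed.
Fact deck_mulV : left_inverse deck_one deck_invg deck_mul.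
Proof. by move=> f; apply: deckP => e /=; rewrite deck_funK. Qed.
Fact deck_mulrV : right_inverse deck_one deck_invg deck_mul.
Proof. by move=> f; apply: deckP => e /=; rewrite deck_invK. Qed.

HB.instance Definition _ := isGroup.Build deck
  deck_mulA deck_mul1 deck_mulr1 deck_mulV deck_mulrV.

End Deck.

Section GroupAutomorphisms.
Context (G : groupType).

Record gaut := GAut {
  gaut_fun :> G -> G;
  gaut_inv : G -> G;
  gaut_funK : cancel gaut_fun gaut_inv;
  gaut_invK : cancel gaut_inv gaut_fun;
  gautM : {morph gaut_fun : x y / x * y}
}.

Lemma gautP (f g : gaut) : f =1 g -> f = g.
Proof.
case: f g => [f f' fK f'K mf] [g g' gK g'K mg] /= /funext fg.
subst g; have E : f' = g' by apply/funext => e; rewrite -{1}(g'K e) fK.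
by subst g'; congr GAut; exact: Prop_irrelevance.
Qed.

Lemma gaut1 (f : gaut) : f 1 = 1.
Proof. by apply: (mulgI (f 1)); rewrite -gautM !mulg1. Qed.

Lemma gautV (f : gaut) : {morph f : x / x^-1}.
Proof. by move=> x; apply: (mulgI (f x)); rewrite -gautM !mulgV gaut1. Qed.

HB.instance Definition _ := gen_eqMixin gaut.
HB.instance Definition _ := gen_choiceMixin gaut.

Definition gaut_one : gaut :=
  @GAut id id (fun=> erefl) (fun=> erefl) (fun _ _ => erefl).

Program Definition gaut_mul (f g : gaut) :=
  @GAut (fun x => f (g x)) (fun x => gaut_inv g (gaut_inv f x)) _ _ _.
Next Obligation. by move=> f g e /=; rewrite !gaut_funK. Qed.
Next Obligation. by move=> f g e /=; rewrite !gaut_invK. Qed.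
Next Obligation. by move=> f g x y /=; rewrite !gautM. Qed.

Program Definition gaut_invg (f : gaut) := @GAut (gaut_inv f) f _ _ _.
Next Obligation. by move=> f; exact: gaut_invK. Qed.
Next Obligation. by move=> f; exact: gaut_funK. Qed.
Next Obligation.
by move=> f x y; apply: (can_inj (gaut_funK f)); rewrite gautM !gaut_invK.
Qed.

Fact gaut_mulA : associative gaut_mul.
Proof. by move=> f g h; exact: gautP. Qed.
Fact gaut_mul1 : left_id gaut_one gaut_mul.
Proof. by move=> f; exact: gautP. Qed.
Fact gaut_mulr1 : right_id gaut_one gaut_mul.
Proof. by move=> f; exact: gautP. Qed.
Fact gaut_mulV : left_inverse gaut_one gaut_invg gaut_mul.
Proof. by move=> f; apply: gautP => e /=; rewrite gaut_funK. Qed.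
Fact gaut_mulrV : right_inverse gaut_one gaut_invg gaut_mul.
Proof. by move=> f; apply: gautP => e /=; rewrite gaut_invK. Qed.

HB.instance Definition _ := isGroup.Build gaut
  gaut_mulA gaut_mul1 gaut_mulr1 gaut_mulV gaut_mulrV.

End GroupAutomorphisms.

Section GroupCoverings.
Context (X : topologicalType).

(* A space over X with a composition law on each fibre: [sp_mul a b] is
   meaningful only when a and b lie over the same point.  Every condition
   below is restricted to such pairs. *)
Record fibre_magma := FibreMagma {
  sp_total :> topologicalType;
  sp_proj : sp_total -> X;
  sp_mul : sp_total -> sp_total -> sp_total
}.

Definition fibre_unit (Z : fibre_magma) (a : Z) :=
  forall b, sp_proj b = sp_proj a -> sp_mul a b = b /\ sp_mul b a = b.

Definition fibrewise_group (Z : fibre_magma) :=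
  [/\ forall a b : Z, sp_proj a = sp_proj b -> sp_proj (sp_mul a b) = sp_proj a,
      forall a b c : Z, sp_proj a = sp_proj b -> sp_proj b = sp_proj c ->
        sp_mul a (sp_mul b c) = sp_mul (sp_mul a b) c,
      forall x, exists2 a : Z, sp_proj a = x & fibre_unit a
    & forall a : Z, exists b, [/\ sp_proj b = sp_proj a,
        fibre_unit (sp_mul a b) & fibre_unit (sp_mul b a)]].

Definition group_covering (Z : fibre_magma) :=
  [/\ continuous (@sp_proj Z),
      forall x, discrete_space (fibre (@sp_proj Z) x),
      fibrewise_group Z
    & forall x, exists2 U, open_nbhs x U &
        exists2 h : @sp_proj Z @^-1` U -> (U * fibre (@sp_proj Z) x)%type,
          trivialization h &
          forall a b c : @sp_proj Z @^-1` U,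
            sp_proj (set_val a) = sp_proj (set_val b) ->
            set_val c = sp_mul (set_val a) (set_val b) ->
            set_val (h c).2 = sp_mul (set_val (h a).2) (set_val (h b).2)].

Definition group_covering_iso (Z Z' : fibre_magma) (f : Z -> Z') :=
  [/\ homeomorphism f,
      forall a, sp_proj (f a) = sp_proj a
    & forall a b, sp_proj a = sp_proj b -> f (sp_mul a b) = sp_mul (f a) (f b)].

End GroupCoverings.

Section Torsors.
Context (X : topologicalType) (Z : fibre_magma X).

(* [ts_act e a] is meaningful only when e and a lie over the same point. *)
Record fibre_act := FibreAct {
  ts_total :> topologicalType;
  ts_proj : ts_total -> X;
  ts_act : ts_total -> Z -> ts_total
}.

Definition is_torsor (E : fibre_act) :=
  [/\ continuous (@ts_proj E),
      {within [set ea : E * Z | ts_proj ea.1 = sp_proj ea.2],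
        continuous (fun ea => ts_act ea.1 ea.2)},
      forall (e : E) (a : Z), ts_proj e = sp_proj a ->
        ts_proj (ts_act e a) = ts_proj e,
      (forall (e : E) (a : Z), ts_proj e = sp_proj a ->
        fibre_unit a -> ts_act e a = e) /\
      (forall (e : E) (a b : Z), ts_proj e = sp_proj a ->
        sp_proj a = sp_proj b ->
        ts_act e (sp_mul a b) = ts_act (ts_act e a) b)
    & forall x, exists2 U, open_nbhs x U &
        exists h : @sp_proj X Z @^-1` U -> @ts_proj E @^-1` U,
        [/\ homeomorphism h,
            forall a, ts_proj (set_val (h a)) = sp_proj (set_val a)
          & forall (a c : @sp_proj X Z @^-1` U) (b : Z),
              sp_proj (set_val a) = sp_proj b ->
              set_val c = sp_mul (set_val a) b ->
              set_val (h c) = ts_act (set_val (h a)) b]].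

Record torsor := Torsor {
  torsor_act :> fibre_act;
  torsorP : is_torsor torsor_act
}.

Definition torsor_hom (E E' : fibre_act) (f : E -> E') :=
  [/\ continuous f,
      forall e, ts_proj (f e) = ts_proj e
    & forall e a, ts_proj e = sp_proj a -> f (ts_act e a) = ts_act (f e) a].

Definition torsor_isomorphic (E E' : fibre_act) :=
  exists (f : E -> E') (g : E' -> E),
    [/\ torsor_hom f, torsor_hom g, cancel f g & cancel g f].

(* Isomorphism classes are predicates on [torsor] and not a [quotType]: the
   universe constraints of the library exclude a choiceType structure on the
   large type [torsor]. *)
Definition iso_class (E : torsor) : torsor -> Prop :=
  fun E' => torsor_isomorphic E' E.

Definition iso_classes := {C : torsor -> Prop | exists E, C = iso_class E}.

End Torsors.

Section Cocycles.
Context (P G : groupType) (phi : {multiplicative P -> gaut G}).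

Record crossed := Crossed {
  crossed_fun :> P -> G;
  crossedM : forall f1 f2,
    crossed_fun (f1 * f2) = crossed_fun f1 * phi f1 (crossed_fun f2)
}.

Lemma crossedP (r s : crossed) : r =1 s -> r = s.
Proof.
case: r s => [r rM] [s sM] /= /funext rs; subst s.
by congr Crossed; exact: Prop_irrelevance.
Qed.

HB.instance Definition _ := gen_eqMixin crossed.
HB.instance Definition _ := gen_choiceMixin crossed.

Lemma phi1 x : phi 1 x = x.
Proof.
suff -> : phi 1 = 1 by [].
by apply: (mulgI (phi 1)); rewrite -gmulfM !mulg1.
Qed.

Lemma phiM f g x : phi (f * g) x = phi f (phi g x).
Proof. by rewrite gmulfM. Qed.

Lemma crossed1 (r : crossed) : r 1 = 1.
Proof. by apply: (mulgI (r 1)); rewrite -{2}[r 1]phi1 -crossedM !mulg1. Qed.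

Program Definition conj_crossed (g : G) (r : crossed) :=
  @Crossed (fun f => g * r f * phi f g^-1) _.
Next Obligation.
by move=> g r f1 f2; rewrite /= crossedM phiM !gautM !gautV !mulgA divgK.
Qed.

Program Definition conj_action : left_action G crossed :=
  @LeftAction G crossed conj_crossed _ _.
Next Obligation.
by move=> r; apply: crossedP => f /=; rewrite invg1 gaut1 mul1g mulg1.
Qed.
Next Obligation.
by move=> g h r; apply: crossedP => f /=; rewrite invgM gautM !mulgA.
Qed.

Definition H1 := orbits conj_action.

End Cocycles.

Section AssociatedSpaces.
Context (X Xt : topologicalType) (p : Xt -> X) (G : groupType).
Context (phi : {multiplicative deck p -> gaut G}).

Local Notation XtG := (Xt * discrete_topology G)%type.

Program Definition tau : left_action (deck p) XtG :=
  @LeftAction _ _ (fun f z => (f z.1, phi f z.2)) _ _.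
Next Obligation. by case=> e g; rewrite /= phi1. Qed.
Next Obligation. by move=> f1 f2 z; rewrite /= phiM. Qed.

Program Definition sigma (rho : crossed phi) : left_action (deck p) XtG :=
  @LeftAction _ _ (fun f z => (f z.1, rho f * phi f z.2)) _ _.
Next Obligation. by move=> rho [e g]; rewrite /= crossed1 phi1 mul1g. Qed.
Next Obligation. by move=> rho f1 f2 z; rewrite /= crossedM phiM gautM mulgA. Qed.

Definition orbit_proj (a : left_action (deck p) XtG) (q : orbit_space a) : X :=
  p (repr q).1.

Lemma orbit_projE (a : left_action (deck p) XtG) z :
  (forall f z, (a f z).1 = f z.1) -> orbit_proj (orbit_class a z) = p z.1.
Proof.
move=> aE; have /orbit_ofP[f zE] :
    orbit_class a (repr (orbit_class a z)) = orbit_class a z.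
  exact: reprK.
by rewrite [in RHS]zE aE deck_over.
Qed.

Lemma deck_free (univ : universal_covering p) (f g : deck p) xi :
  f xi = g xi -> f = g.
Proof.
case: univ => cp [_ cXt _] fg; apply: deckP.
apply: (unique_lift cp cXt); [exact: deck_fun_continuous
  |exact: deck_fun_continuous| |by exists xi].
by move=> e /=; rewrite !deck_over.
Qed.

(* Relational form of [xi, g] * [xi, d] = [xi, g * d]; it is single-valued
   by [quot_mulE]. *)
Definition quot_mul (q r : orbit_space tau) : orbit_space tau :=
  xget q [set s | exists xi (g d : G),
    [/\ q = orbit_class tau (xi, g), r = orbit_class tau (xi, d)
      & s = orbit_class tau (xi, g * d)]].

Lemma quot_mulE (univ : universal_covering p) xi (g d : G) :
  quot_mul (orbit_class tau (xi, g)) (orbit_class tau (xi, d)) =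
  orbit_class tau (xi, g * d).
Proof.
rewrite /quot_mul; case: xgetP => [s _ [xi' [g' [d' [E1 E2 ->]]]]|]; last first.
  by move=> /(_ (orbit_class tau (xi, g * d))) []; exists xi, g, d.
move/orbit_ofP: E1 => [f [fx fg]]; move/orbit_ofP: E2 => [f' [fx' fd]].
have ff : f = f' by apply: (@deck_free univ _ _ xi); rewrite -fx.
subst f'; apply/esym/orbit_ofP; exists f => /=; by rewrite gautM fg fd fx.
Qed.

Definition quot_group : fibre_magma X :=
  FibreMagma (@orbit_proj tau) quot_mul.

Context (Z : fibre_magma X) (Theta : quot_group -> Z) (rho : crossed phi).

(* Relational form of [xi, g] . Theta [xi, d] = [xi, g * d]; it is
   single-valued by [quot_actE]. *)
Definition quot_act (q : orbit_space (sigma rho)) (a : Z) :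
    orbit_space (sigma rho) :=
  xget q [set s | exists xi (g d : G),
    [/\ q = orbit_class (sigma rho) (xi, g), a = Theta (orbit_class tau (xi, d))
      & s = orbit_class (sigma rho) (xi, g * d)]].

Lemma quot_actE (univ : universal_covering p) xi (g d : G) :
  group_covering_iso Theta ->
  quot_act (orbit_class (sigma rho) (xi, g)) (Theta (orbit_class tau (xi, d))) =
  orbit_class (sigma rho) (xi, g * d).
Proof.
move=> [[_ [k [_ Tk _]]] _ _].
rewrite /quot_act.
case: xgetP => [s _ [xi' [g' [d' [E1 /(can_inj Tk) E2 ->]]]]|]; last first.
  by move=> /(_ (orbit_class (sigma rho) (xi, g * d))) []; exists xi, g, d.
move/orbit_ofP: E1 => [f [fx fg]]; move/orbit_ofP: E2 => [f' [fx' fd]].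
have ff : f = f' by apply: (@deck_free univ _ _ xi); rewrite -fx.
subst f'; apply/esym/orbit_ofP; exists f => /=; by rewrite gautM fg fd fx mulgA.
Qed.

Definition quot_torsor : fibre_act Z :=
  FibreAct (@orbit_proj (sigma rho)) quot_act.

End AssociatedSpaces.

(* Main.v *)
Require Import Defs.
From mathcomp Require Import all_boot all_order all_algebra.
From mathcomp Require Import all_classical topology.

(** Everything rests on two facts about the universal covering [p : Xt -> X]:
    maps into coverings of [X] lift from the simply connected space [Xt]
    ([simply_connected_lift]), and such lifts are determined by one value
    ([unique_lift]).  Lifts exist without any local connectedness, because a
    lift is a section of a pulled-back covering, which is trivial by definition
    of simple connectedness.

    Applied to [p] itself they show that the deck group acts simply
    transitively on the fibres of [p].  Hence a point [xi] of [Xt] identifies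
    [G] with the fibre over [p xi] of each quotient of [Xt * G], and a sheet of
    [p] trivializes all these quotients at once; this makes the spaces
    associated with crossed morphisms torsors ([quot_torsorP]).

    Every torsor [E] is a covering of [X], being locally homeomorphic to the
    group covering.  So [p] lifts to a map [s : Xt -> E].  As the fibres of [E]
    are simply transitive, [s (f xi)] and [s xi] differ by an element of the
    group covering with coordinates [(f xi, rho f)]; uniqueness of lifts makes
    [rho f] independent of [xi], and [rho] is a crossed morphism
    ([section_twisted]).  The translates of [s] by constants of [G] then define
    a morphism from the torsor associated with [rho] to [E], and a morphism of
    torsors is always an isomorphism ([torsor_hom_isomorphic]).

    A morphism between two associated torsors is determined by the image of
    the constant section with value [1].  That image is again a constant
    section, with some value [g], by uniqueness of lifts; compatibility with
    the two actions says that [g] conjugates one crossed morphism into the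
    other ([quot_torsor_isomorphicP]).  The bijection with the cohomology set
    is a formal consequence. *)

Set Implicit Arguments.
Unset Strict Implicit.

Local Open Scope classical_set_scope.

(** * Point-set preliminaries *)

(** Pointwise form of openness, which composes directly with the neighbourhood
    formulation of continuity. *)
Definition open_map (S T : topologicalType) (f : S -> T) :=
  forall x A, nbhs x A -> nbhs (f x) (f @` A).

Definition set_elt (T : Type) (A : set T) x (Ax : A x) : A := exist _ x (mem_set Ax).

Lemma open_nbhsW (T : topologicalType) (A : set T) x : open A -> A x -> nbhs x A.
Proof. by move=> oA Ax; exact: (@open_nbhs_nbhs T x A (conj oA Ax)). Qed.

Lemma continuous_nbhs (S T : topologicalType) (f : S -> T) x A :
  continuous f -> nbhs (f x) A -> nbhs x (f @^-1` A).
Proof. by move=> cf; exact: cf. Qed.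

Lemma continuous_pair (S T U : topologicalType) (f : S -> T) (g : S -> U) :
  continuous f -> continuous g -> continuous (fun x => (f x, g x)).
Proof.
move=> cf cg x A [[B C] /= [Bf Cg] BCA].
have xB : nbhs x (f @^-1` B) by exact: cf.
have xC : nbhs x (g @^-1` C) by exact: cg.
apply: filterS2 xB xC => y By Cy.
exact: (BCA (f y, g y)).
Qed.

Lemma open_map_open (S T : topologicalType) (f : S -> T) A :
  open_map f -> open A -> open (f @` A).
Proof.
move=> fo oA; rewrite openE => _ [x Ax <-].
by apply: fo; exact: open_nbhsW.
Qed.

Lemma homeomorphism_open_map (S T : topologicalType) (f : S -> T) :
  homeomorphism f -> open_map f.
Proof.
move=> [cf [g [cg fK gK]]] x A Ax.
have : nbhs (g (f x)) A by rewrite fK.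
by move/(continuous_nbhs cg); apply: filterS => y /= Agy; exists (g y); rewrite ?gK.
Qed.

Lemma nbhs_set_type (T : topologicalType) (A : set T) (x : A) (B : set A) :
  nbhs x B <-> exists2 W, nbhs (set_val x) W & set_val @^-1` W `<=` B.
Proof.
split=> [xB|[W Wx WB]].
  have [_ [[W oW <-] Wx] CB] : exists2 C, open_nbhs x C & C `<=` B.
    by move: xB; rewrite nbhsE.
  by exists W => //; exact: open_nbhsW.
move: Wx; rewrite nbhsE => -[W' [oW' W'x] W'W].
rewrite nbhsE; exists (set_val @^-1` W'); first by split => //; exists W'.
by move=> z /= /W'W; exact: WB.
Qed.

Lemma set_val_continuous (T : topologicalType) (A : set T) :
  continuous (set_val : A -> T).
Proof. exact: initial_continuous. Qed.

Lemma set_val_open_map (T : topologicalType) (A : set T) :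
  open A -> open_map (set_val : A -> T).
Proof.
move=> oA x B /nbhs_set_type[W Wx WB].
have Ax : nbhs (set_val x) A by apply: open_nbhsW => //; exact: set_valP.
apply: filterS2 Wx Ax => y Wy Ay.
by exists (set_elt Ay) => //; apply: WB.
Qed.

Lemma continuous_set_type (S T : topologicalType) (A : set T) (f : S -> A) :
  continuous (set_val \o f) -> continuous f.
Proof. exact: continuous_comp_initial. Qed.

(** Reduces the construction of homeomorphisms between subtypes to a pair of
    total functions that are mutually inverse, and continuous, on the subsets
    only; outside them the functions may take junk values. *)
Lemma homeomorphism_restrict (S T : topologicalType) (A : set S) (B : set T)
    (f : S -> T) (g : T -> S) :
  (forall x, A x -> [/\ B (f x), g (f x) = x & {for x, continuous f}]) ->
  (forall y, B y -> [/\ A (g y), f (g y) = y & {for y, continuous g}]) ->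
  exists2 h : A -> B, homeomorphism h & forall a, set_val (h a) = f (set_val a).
Proof.
move=> fP gP.
have fB (a : A) : B (f (set_val a)) by have [] := fP _ (set_valP a).
have gA (b : B) : A (g (set_val b)) by have [] := gP _ (set_valP b).
exists (fun a => set_elt (fB a)) => //; split.
  apply: continuous_set_type => a.
  have [_ _ fa] := fP _ (set_valP a).
  apply: (@continuous_comp _ _ _ set_val f) => //; exact: set_val_continuous.
exists (fun b => set_elt (gA b)); split.
- apply: continuous_set_type => b.
  have [_ _ gb] := gP _ (set_valP b).
  apply: (@continuous_comp _ _ _ set_val g) => //; exact: set_val_continuous.
- move=> a; apply: val_inj => /=; by have [] := fP _ (set_valP a).
- move=> b; apply: val_inj => /=; by have [] := gP _ (set_valP b).
Qed.

Lemma nbhs_prod_discrete (T : topologicalType) (D : discreteTopologicalType)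
    (z : T * D) (A : set (T * D)) :
  nbhs z A <-> nbhs z.1 [set t | A (t, z.2)].
Proof.
case: z => t d /=; split=> [[[B C] /= [Bt Cd] BCA]|At].
  by apply: filterS Bt => u Bu; apply: BCA; split=> //=; exact: nbhs_singleton Cd.
exists ([set u | A (u, d)], [set d]) => /=; first by split => //; exact: discrete_set1.
by move=> [u _] [/= Au ->].
Qed.

(** * Coverings in terms of sheets *)

Section Sheets.
Context (E X : topologicalType) (p : E -> X).

(** The sheets [V i] are disjoint, cover [p @^-1` U] and are each mapped
    bijectively onto [U].  Unlike a trivialization this involves neither
    subtypes nor products, which makes it convenient for transporting the
    covering property; the index type is free for the same reason. *)
Definition sheets (U : set X) (I : Type) (V : I -> set E) :=
  [/\ forall i, open (V i),
      forall a, U (p a) <-> exists i, V i a,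
      forall i j a, V i a -> V j a -> i = j,
      forall i a b, V i a -> V i b -> p a = p b -> a = b
    & forall i u, U u -> exists2 a, V i a & p a = u].

Lemma covering_continuous : covering p -> continuous p.
Proof. by case. Qed.

(** Through each point passes a continuous local section, so a neighbourhood
    of that point pulls back to a neighbourhood of its projection. *)
Lemma covering_open_map : covering p -> open_map p.
Proof.
move=> [cp _ /(_ (p _)) ct] a A; rewrite nbhsE => -[B [oB Ba] BA].
have [U [oU Ua] [h [[ch [k [ck hk kh]]] hp]]] := ct a.
pose z : p @^-1` U := @set_elt _ (p @^-1` U) a Ua.
have B'z : nbhs z [set z | B (set_val z)].
  by apply/nbhs_set_type; exists B => //; exact: open_nbhsW.
have : nbhs (k (h z)) [set z | B (set_val z)] by rewrite hk.
move/(continuous_nbhs ck) => -[[N M] /= [Nz Mz] NM].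
move/nbhs_set_type: Nz => [W Wa WN].
have W' : nbhs (p a) W by move: Wa; rewrite hp.
have U' : nbhs (p a) U by exact: open_nbhsW.
apply: filterS2 W' U' => u Wu Uu.
pose v : U := set_elt Uu.
exists (set_val (k (v, (h z).2))).
  apply: BA; apply: (NM (v, (h z).2)); split => /=; first exact: WN.
  exact: nbhs_singleton Mz.
by rewrite -hp kh.
Qed.

Lemma covering_sheetsP x : covering p ->
  exists2 U, open_nbhs x U & exists V : fibre p x -> set E, sheets U V.
Proof.
case=> cp dp /(_ x)[U oU [h [[ch [k [ck hk kh]]] hp]]]; exists U => //.
have oPU : open (p @^-1` U) by move/continuousP: cp; apply; exact: oU.1.
exists (fun c => set_val @` [set z | (h z).2 = c]); split.
- move=> c; apply: open_map_open; first exact: set_val_open_map.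
  have cs : continuous (fun z => (h z).2).
    by move=> z; apply: continuous_comp; [exact: ch|exact: cvg_snd].
  by have := dp x [set c]; move/continuousP: cs => /[apply].
- move=> a; split=> [Ua|[_ [z _ <-]]]; last exact: (set_valP z).
  pose z : p @^-1` U := @set_elt _ (p @^-1` U) a Ua.
  by exists (h z).2, z.
- move=> c c' a [z <- za] [z' <- E1]; congr (h _).2.
  by apply: val_inj; rewrite -!set_valE za E1.
- move=> c _ _ [z <- <-] [z' hz' <-] pe; congr set_val.
  apply: (can_inj hk); rewrite [h z]surjective_pairing [h z']surjective_pairing hz'.
  congr pair.
  by apply: val_inj; have := hp z; have := hp z'; rewrite !set_valE => -> ->.
- move=> c u Uu; exists (set_val (k (set_elt Uu, c))).
    by eexists; last reflexivity; rewrite /= kh.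
  by rewrite -hp kh.
Qed.

(** Given sheets over a neighbourhood of [x], each sheet contains exactly one
    point of the fibre of [x], so the fibre can serve as the index set: the
    trivialization records the projection of a point and the point of the
    fibre that lies in the same sheet. *)
Lemma sheets_covering : continuous p -> open_map p ->
  (forall x, exists2 U, open_nbhs x U &
     exists I (V : I -> set E), sheets U V) -> covering p.
Proof.
move=> cp op sp; split=> // x; case: (sp x) => U [oU Ux] [I [V [oV UV Vd Vi Vs]]].
  move=> A; rewrite openE => c Ac; apply/nbhs_set_type.
  have pc : p (set_val c) = x by exact: (set_valP c).
  have [i Vc] : exists i, V i (set_val c) by apply/UV; rewrite pc.
  exists (V i); first exact: open_nbhsW.
  move=> d /= Vd'; suff -> : d = c by [].
  by apply: val_inj; apply: Vi Vd' Vc _; rewrite pc; exact: (set_valP d).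
exists U => //.
have cE (a : p @^-1` U) :
    {c : fibre p x | exists i, V i (set_val a) /\ V i (set_val c)}.
  apply: cid; have /UV[i Va] : U (p (set_val a)) by exact: (set_valP a).
  have [b Vb pb] := Vs i x Ux.
  by exists (@set_elt _ (fibre p x) b pb), i.
have kE (uc : U * fibre p x) : {a : p @^-1` U | p (set_val a) = set_val uc.1 /\
    exists i, V i (set_val a) /\ V i (set_val uc.2)}.
  case: uc => u c; apply: cid => /=.
  have [i Vc] : exists i, V i (set_val c).
    by apply/UV; rewrite [p _](set_valP c).
  have Uu : U (set_val u) by exact: (set_valP u).
  have [a Va pa] := Vs i _ Uu.
  have Ua : U (p a) by rewrite pa.
  by exists (@set_elt _ (p @^-1` U) a Ua); split=> //; exists i.
have pU (a : p @^-1` U) : U (p (set_val a)) by exact: (set_valP a).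
pose h a : U * fibre p x := (set_elt (pU a), projT1 (cE a)).
exists h; split=> //; split; last exists (fun uc => projT1 (kE uc)); last split.
- apply: continuous_pair; first apply: continuous_set_type => a.
    apply: (@continuous_comp _ _ _ set_val p); first exact: set_val_continuous.
    exact: cp.
  move=> a A /nbhs_singleton; rewrite /h /=; case: (cE a) => c /= [i [Va Vc]] Ac.
  apply/nbhs_set_type; exists (V i); first exact: open_nbhsW.
  move=> b /= Vb; case: (cE b) => d /= [j [Vjb Vjd]].
  suff -> : d = c by [].
  apply: val_inj; apply: (Vi i) => //.
    by rewrite (Vd _ _ _ Vb Vjb).
  by rewrite [LHS](set_valP d) [RHS](set_valP c).
- apply: continuous_set_type => -[u c] A /=; rewrite nbhs_simpl.
  case: (kE (u, c)) => a /= [pa [i [Va Vc]]] Aa.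
  have AV : nbhs (set_val a) (A `&` V i).
    by apply: filterI => //; exact: open_nbhsW.
  exists (set_val @^-1` (p @` (A `&` V i)), set_val @^-1` (V i)) => /=.
    split; apply/nbhs_set_type;
      first by exists (p @` (A `&` V i)) => //; rewrite -pa; exact: op.
    by exists (V i) => //; exact: open_nbhsW.
  move=> [v d] [/= [b [Ab Vb] pb] Vid].
  case: (kE (v, d)) => b' /= [pb' [j [Vjb Vjd]]].
  suff -> : set_val b' = b by [].
  apply: (Vi i) => //; last by rewrite pb' pb.
  by rewrite (Vd _ _ _ Vid Vjd).
- move=> a; rewrite /h; case: (cE a) => c /= [i [Va Vc]].
  case: (kE _) => b /= [pb [j [Vjb Vjc]]].
  apply: val_inj; apply: (Vi i) => //.
  by rewrite (Vd _ _ _ Vc Vjc).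
- move=> [u c]; rewrite /h; case: (kE _) => a /= [pa [i [Va Vc]]].
  congr pair; first exact: val_inj.
  case: (cE _) => d /= [j [Vja Vjd]].
  apply: val_inj; apply: (Vi j) => //; first by rewrite (Vd _ _ _ Vja Va).
  by rewrite [LHS](set_valP d) [RHS](set_valP c).
Qed.

Lemma covering_nbhs_inj e : covering p ->
  exists2 V, open_nbhs e V & forall a b, V a -> V b -> p a = p b -> a = b.
Proof.
move=> /(covering_sheetsP (p e))[U [_ Ue] [V [oV UV _ Vi _]]].
have /UV[i Ve] := Ue.
by exists (V i) => // a b; exact: Vi.
Qed.

(** Over an evenly covered open set the fibres are all empty or all nonempty,
    so the image is open and closed. *)
Lemma covering_surjective : covering p -> connected [set: X] -> E ->
  forall x, exists e, p e = x.
Proof.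
move=> cp cX e0; pose A := range p.
suff : A = setT by move=> AT x; have : setT x by []; rewrite -AT => -[e _]; exists e.
apply: cX; first by exists (p e0), e0.
  exists A; last by rewrite setTI.
  apply: open_map_open; [exact: covering_open_map|exact: openT].
exists A; last by rewrite setTI.
rewrite -[A]setCK; apply: open_closedC; rewrite openE => x nAx.
have [U [oU Ux] [V [oV UV Vd Vi Vs]]] := covering_sheetsP x cp.
have : nbhs x U by exact: open_nbhsW.
apply: filterS => u Uu [a _ pa]; have /UV[i _] : U (p a) by rewrite pa.
by have [b _ pb] := Vs i _ Ux; apply: nAx; exists b.
Qed.

End Sheets.

Definition fibre_product (Y E X : Type) (g : Y -> X) (p : E -> X) : set (Y * E) :=
  [set ye | g ye.1 = p ye.2].

(** The sheets of the pullback are the preimages of the sheets of [p]. *)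
Lemma covering_pullback (Y E X : topologicalType) (p : E -> X) (g : Y -> X) :
  covering p -> continuous g ->
  covering (fun z : fibre_product g p => (set_val z).1).
Proof.
move=> cp cg; apply: sheets_covering.
- move=> z; apply: (@continuous_comp _ _ _ set_val fst).
    exact: set_val_continuous.
  exact: cvg_fst.
- move=> z A /nbhs_set_type[W [[B C] /= [Bz Cz] BCW] WA].
  have gC : nbhs (set_val z).1 (g @^-1` (p @` C)).
    apply: continuous_nbhs => //; rewrite [g _](set_valP z); exact: covering_open_map.
  apply: filterS2 Bz gC => y By [e Ce pe].
  exists (@set_elt _ (fibre_product g p) (y, e) (esym pe)) => //; apply: WA.
  exact: (BCW (y, e)).
- move=> y; have [U [oU Uy] [V [oV UV Vd Vi Vs]]] := covering_sheetsP (g y) cp.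
  exists (g @^-1` U); first by split=> //; move/continuousP: cg; apply.
  exists (fibre p (g y)), (fun i => [set z | V i (set_val z).2]); split.
  + move=> i; have c2 : continuous
        (fun z : fibre_product g p => (set_val z).2).
      move=> z; apply: (@continuous_comp _ _ _ set_val snd).
        exact: set_val_continuous.
      exact: cvg_snd.
    by move/continuousP: c2; exact.
  + by move=> z; rewrite /= [g _](set_valP z); exact: UV.
  + by move=> i j z; exact: Vd.
  + move=> i z z' Vz Vz' zz'; apply: val_inj.
    rewrite -!set_valE [set_val z]surjective_pairing [RHS]surjective_pairing zz'.
    congr pair.
    apply: Vi Vz Vz' _; rewrite -[LHS](set_valP z) -[RHS](set_valP z').
    by rewrite zz'.
  + move=> i u Uu; have [a Va pa] := Vs i _ Uu.
    by exists (@set_elt _ (fibre_product g p) (u, a) (esym pa)).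
Qed.

(** A lift of [g] is a section of the pulled-back covering of [Y], which is
    trivial: take the constant section through the given point. *)
Lemma simply_connected_lift (Y E X : topologicalType) (p : E -> X)
    (g : Y -> X) y0 e0 :
  simply_connected Y -> covering p -> continuous g -> g y0 = p e0 ->
  exists s : Y -> E, [/\ continuous s, forall y, p (s y) = g y & s y0 = e0].
Proof.
move=> [_ _ tY] cp cg ge0.
have [F [h [[_ [k [ck hk kh]]] hp]]] := tY _ _ (covering_pullback cp cg).
pose z0 : fibre_product g p := @set_elt _ (fibre_product g p) (y0, e0) ge0.
exists (fun y => (set_val (k (y, (h z0).2))).2); split.
- move=> y; apply: (@continuous_comp _ _ _ (fun y => k (y, (h z0).2)) (fun z => (set_val z).2)).
    apply: (@continuous_comp _ _ _ (fun y => (y, (h z0).2)) k); last exact: ck.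
    by apply: continuous_pair => ?; [exact: cvg_id|exact: cvg_cst].
  apply: (@continuous_comp _ _ _ set_val snd); first exact: set_val_continuous.
  exact: cvg_snd.
- move=> y; rewrite -[LHS](set_valP (k (y, (h z0).2))).
  by rewrite -hp kh.
- rewrite (_ : (y0, (h z0).2) = h z0) ?hk//.
  by rewrite [RHS]surjective_pairing hp.
Qed.

(** * Torsors under a group covering *)

(** Being a covering is local on the base, so it may be transferred along
    homeomorphisms that exist only over the members of an open cover. *)
Lemma covering_local (E E' X : topologicalType) (p : E -> X) (q : E' -> X) :
  covering p -> continuous q ->
  (forall x, exists2 U, open_nbhs x U & exists2 h : p @^-1` U -> q @^-1` U,
     homeomorphism h & forall a, q (set_val (h a)) = p (set_val a)) ->
  covering q.
Proof.
move=> cp cq loc; apply: sheets_covering => //.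
- move=> e A Ae; have [U [oU Ue] [h [ch [k [ck hk kh]]] qh]] := loc (q e).
  have oPU : open (p @^-1` U).
    by have /continuousP := covering_continuous cp; apply.
  pose b : q @^-1` U := @set_elt _ (q @^-1` U) e Ue.
  have NB : nbhs (k b) [set z | A (set_val (h z))].
    apply: (@continuous_nbhs _ _ (set_val \o h)); last by rewrite /= kh.
    move=> z; apply: continuous_comp; [exact: ch|exact: set_val_continuous].
  have /(covering_open_map cp) := set_val_open_map oPU NB.
  rewrite -qh kh; apply: filterS => _ [_ [z Az <-] <-].
  by exists (set_val (h z)).
- move=> x; have [U oU [h [ch [k [ck hk kh]]] qh]] := loc x.
  have [U' oU' [V [oV UV Vd Vi Vs]]] := covering_sheetsP x cp.
  exists (U `&` U').
    by split; [apply: openI; [case: oU|case: oU']|split; [case: oU|case: oU']].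
  exists (fibre p x), (fun i => set_val @` [set b : q @^-1` U |
    V i (set_val (k b)) ]).
  have pk (b : q @^-1` U) : p (set_val (k b)) = q (set_val b) by rewrite -qh kh.
  split.
  + move=> i; apply: open_map_open.
      by apply: set_val_open_map; move/continuousP: cq; apply; case: oU.
    have ck' : continuous (fun b => set_val (k b)).
      by move=> b; apply: continuous_comp; [exact: ck|exact: set_val_continuous].
    by move/continuousP: ck'; exact.
  + move=> a; split=> [[Ua U'a]|[i [b /= Vb <-]]].
      pose b : q @^-1` U := @set_elt _ (q @^-1` U) a Ua.
      have /UV[i Vb] : U' (p (set_val (k b))) by rewrite pk.
      by exists i, b.
    split; first exact: (set_valP b).
    by rewrite -pk; apply/UV; exists i.
  + move=> i j a [b Vb <-] [b' Vb' bb']; apply: Vd Vb _.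
    by have <- : b' = b by apply: val_inj.
  + move=> i _ _ [b Vb <-] [b' Vb' <-] bb'; congr set_val.
    apply: (can_inj kh); apply: val_inj; apply: (Vi i) => //.
    by rewrite !pk.
  + move=> i u [Uu U'u]; have [a Va pa] := Vs i _ U'u.
    have Ua : U (p a) by rewrite pa.
    pose z : p @^-1` U := @set_elt _ (p @^-1` U) a Ua.
    exists (set_val (h z)); last by rewrite qh.
    by exists (h z) => //=; rewrite hk.
Qed.

Section FibrewiseGroups.
Context (X : topologicalType) (Z : fibre_magma X).
Hypothesis grZ : fibrewise_group Z.

Lemma fibre_mul_inj (a b c : Z) :
  sp_proj a = sp_proj b -> sp_proj a = sp_proj c ->
  sp_mul a b = sp_mul a c -> b = c.
Proof.
have [pM mulA _ inv] := grZ => ab ac e.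
have [a' [pa' _ u]] := inv a.
have u1 d : sp_proj a = sp_proj d -> sp_mul (sp_mul a' a) d = d.
  by move=> ad; have [] := u d _; rewrite // pM // pa' ad.
by rewrite -(u1 b) // -(u1 c) // -!mulA ?e.
Qed.

Lemma fibre_mul_surj (a b : Z) : sp_proj a = sp_proj b ->
  exists2 c, sp_proj a = sp_proj c & sp_mul a c = b.
Proof.
have [pM mulA _ inv] := grZ => ab.
have [a' [pa' u _]] := inv a.
exists (sp_mul a' b); first by rewrite pM // pa' ab.
rewrite mulA ?pa' //; have [] := u b _ => //.
by rewrite pM.
Qed.

End FibrewiseGroups.

Section TorsorTheory.
Context (X : topologicalType) (Z : fibre_magma X).
Hypothesis covZ : group_covering Z.

Lemma group_covering_covering : covering (@sp_proj X Z).
Proof.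
case: covZ => cZ dZ _ tZ; split=> // x; have [U oU [h th _]] := tZ x.
by exists U => //; exists h.
Qed.

Lemma group_covering_group : fibrewise_group Z.
Proof. by case: covZ. Qed.

Section OneTorsor.
Context (E : fibre_act Z).
Hypothesis torE : is_torsor E.

Lemma torsor_proj_continuous : continuous (@ts_proj X Z E).
Proof. by case: torE. Qed.

Lemma torsor_act_proj (e : E) (a : Z) : ts_proj e = sp_proj a ->
  ts_proj (ts_act e a) = ts_proj e.
Proof. by case: torE => _ _ /(_ e a). Qed.

Lemma torsor_act1 (e : E) (a : Z) : ts_proj e = sp_proj a ->
  fibre_unit a -> ts_act e a = e.
Proof. by case: torE => _ _ _ [/(_ e a)]. Qed.

Lemma torsor_actM (e : E) (a b : Z) : ts_proj e = sp_proj a ->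
  sp_proj a = sp_proj b -> ts_act e (sp_mul a b) = ts_act (ts_act e a) b.
Proof. by case: torE => _ _ _ [_ /(_ e a b)]. Qed.

Lemma torsor_act_continuous (Y : topologicalType) (f : Y -> E) (g : Y -> Z) :
  continuous f -> continuous g -> (forall y, ts_proj (f y) = sp_proj (g y)) ->
  continuous (fun y => ts_act (f y) (g y)).
Proof.
have [_ /subspace_continuousP act_cont _ _ _] := torE => cf cg fg y W Wfg.
have /= : nbhs (f y, g y) [set ea | ts_proj ea.1 = sp_proj ea.2 ->
    W (ts_act ea.1 ea.2)].
  exact: (act_cont (f y, g y) (fg y) W Wfg).
move/(continuous_nbhs (continuous_pair cf cg)); apply: filterS => t /=; exact.
Qed.

(** Locally a torsor looks like the group covering itself. *)
Lemma torsor_covering : covering (@ts_proj X Z E).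
Proof.
case: torE => cE _ _ _ tE; apply: (covering_local group_covering_covering) => // x.
by have [U oU [h [hh hp _]]] := tE x; exists U => //; exists h.
Qed.

Lemma torsor_fibre_nonempty x : exists e : E, ts_proj e = x.
Proof.
have [_ _ /(_ x)[a ax _] _] := group_covering_group.
have [_ _ _ _ /(_ x)[U [oU Ux] [h [_ hp _]]]] := torE.
have Ua : U (sp_proj a) by rewrite ax.
by exists (set_val (h (@set_elt _ (@sp_proj X Z @^-1` U) a Ua))); rewrite hp.
Qed.

(** Together with [torsor_act_inj]: the fibres of a torsor are simply
    transitive, because those of the group covering are. *)
Lemma torsor_divide (e e' : E) : ts_proj e = ts_proj e' ->
  exists2 a : Z, ts_proj e = sp_proj a & ts_act e a = e'.
Proof.
move=> ee'; have [_ _ _ _ /(_ (ts_proj e))[U [oU Ue] [h [hh hp hact]]]] := torE.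
case: hh => _ [k [_ hk kh]].
have Ue' : U (ts_proj e') by rewrite -ee'.
pose b := k (@set_elt _ (@ts_proj X Z E @^-1` U) e Ue).
pose b' := k (@set_elt _ (@ts_proj X Z E @^-1` U) e' Ue').
have pb : sp_proj (set_val b) = ts_proj e by rewrite -hp kh.
have pb' : sp_proj (set_val b') = ts_proj e' by rewrite -hp kh.
have [|c pc bc] := fibre_mul_surj group_covering_group (a := set_val b) (b := set_val b').
  by rewrite pb pb'.
exists c; first by rewrite -pb.
by have := hact b b' c pc (esym bc); rewrite !kh.
Qed.

Lemma torsor_act_inj (e : E) (a b : Z) :
  ts_proj e = sp_proj a -> ts_proj e = sp_proj b ->
  ts_act e a = ts_act e b -> a = b.
Proof.
move=> ea eb; have [_ _ _ _ /(_ (ts_proj e))[U [oU Ue] [h [hh hp hact]]]] := torE.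
case: hh => _ [k [_ hk kh]].
have [pM _ _ _] := group_covering_group.
pose z := k (@set_elt _ (@ts_proj X Z E @^-1` U) e Ue).
have pz : sp_proj (set_val z) = ts_proj e by rewrite -hp kh.
have Um c : ts_proj e = sp_proj c -> U (sp_proj (sp_mul (set_val z) c)).
  by move=> ec; rewrite pM ?pz.
pose za := @set_elt _ (@sp_proj X Z @^-1` U) _ (Um a ea).
pose zb := @set_elt _ (@sp_proj X Z @^-1` U) _ (Um b eb).
have := hact z za a; have := hact z zb b; rewrite !kh /= => Hb Ha Eab.
apply: (fibre_mul_inj group_covering_group (a := set_val z)); rewrite ?pz //.
have : h za = h zb by apply: val_inj; rewrite -!set_valE Ha ?Hb ?pz.
by move/(can_inj hk)/(congr1 set_val).
Qed.

End OneTorsor.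

Section TorsorMorphisms.
Context (E E' : fibre_act Z) (f : E -> E').
Hypotheses (torE : is_torsor E) (torE' : is_torsor E') (homf : torsor_hom f).

Lemma torsor_hom_inj : injective f.
Proof.
case: homf => cf pf af e1 e2 f12.
have e12 : ts_proj e1 = ts_proj e2 by rewrite -pf f12 pf.
have [a pa ea] := torsor_divide torE e12; move: f12; rewrite -ea => f12.
have [_ _ /(_ (ts_proj e1))[u pu uu] _] := group_covering_group.
suff -> : a = u by rewrite (torsor_act1 torE).
apply: (torsor_act_inj torE' (e := f e1)); rewrite ?pf ?pu //.
by rewrite -af // -f12 (torsor_act1 torE' (a := u)) ?pf.
Qed.

Lemma torsor_hom_surj e' : exists e, f e = e'.
Proof.
case: homf => cf pf af.
have [e ee'] := torsor_fibre_nonempty torE (ts_proj e').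
have [|a pa ea] := torsor_divide torE' (e := f e) (e' := e'); first by rewrite pf.
by exists (ts_act e a); rewrite af // -pf.
Qed.

(** Any continuous map over [X] between coverings is open, since near each
    point both projections are open and injective. *)
Lemma torsor_hom_open_map : open_map f.
Proof.
case: homf => cf pf af e A Ae.
have [W [oW We] Winj] := covering_nbhs_inj (f e) (torsor_covering torE').
have NAW : nbhs e (A `&` f @^-1` W).
  by apply: filterI => //; apply: continuous_nbhs => //; exact: open_nbhsW.
have /(_ _ _ NAW) := covering_open_map (torsor_covering torE).
rewrite -pf => N1.
have N2 := continuous_nbhs (torsor_proj_continuous torE') N1.
apply: filterS2 N2 (open_nbhsW oW We) => w [a [Aa Wa] aw] Ww.
by exists a => //; apply: Winj => //; rewrite pf.
Qed.

(** An equivariant map between simply transitive fibres is bijective, and it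
    is open, so its inverse is continuous.  Isomorphisms of torsors can thus
    be produced by giving a morphism in one direction. *)
Lemma torsor_hom_isomorphic : torsor_isomorphic E E'.
Proof.
case: (homf) => cf pf af.
have [g fg] := choice torsor_hom_surj.
have gf e : g (f e) = e by apply: torsor_hom_inj; rewrite fg.
exists f, g; split=> //; split.
- move=> e' A Ae; have := torsor_hom_open_map Ae; rewrite fg.
  by apply: filterS => _ [a Aa <-] /=; rewrite gf.
- by move=> e'; rewrite -pf fg.
- move=> e' a ea; apply: torsor_hom_inj; rewrite fg af ?fg //.
  by rewrite -pf fg.
Qed.

End TorsorMorphisms.

Lemma torsor_isomorphic_refl (E : fibre_act Z) : torsor_isomorphic E E.
Proof. by exists id, id; split=> //; split=> // ?; exact: cvg_id. Qed.

Lemma torsor_isomorphic_sym (E E' : fibre_act Z) :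
  torsor_isomorphic E E' -> torsor_isomorphic E' E.
Proof. by case=> f [g [hf hg fg gf]]; exists g, f. Qed.

Lemma torsor_hom_comp (E1 E2 E3 : fibre_act Z) (f : E1 -> E2) (g : E2 -> E3) :
  torsor_hom f -> torsor_hom g -> torsor_hom (g \o f).
Proof.
move=> [cf pf af] [cg pg ag]; split.
- by move=> e; apply: continuous_comp; [exact: cf|exact: cg].
- by move=> e; rewrite /= pg pf.
- by move=> e a ea; rewrite /= af // ag // pf.
Qed.

Lemma torsor_isomorphic_trans (E1 E2 E3 : fibre_act Z) :
  torsor_isomorphic E1 E2 -> torsor_isomorphic E2 E3 -> torsor_isomorphic E1 E3.
Proof.
move=> [f [f' [hf hf' ff' f'f]]] [g [g' [hg hg' gg' g'g]]].
exists (g \o f), (f' \o g'); split; try exact: torsor_hom_comp.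
  by move=> e /=; rewrite gg' ff'.
by move=> e /=; rewrite f'f g'g.
Qed.

End TorsorTheory.

Local Open Scope group_scope.

(** * Orbit spaces of deck groups *)

Section Deck.
Context (X Xt : topologicalType) (p : Xt -> X).
Hypothesis univ : universal_covering p.

(** The universal covering is Galois.  Lift [p] to itself in both directions;
    the two composites fix a point and hence are the identity by uniqueness
    of lifts. *)
Lemma deck_transitive e e' : p e = p e' -> exists f : deck p, f e = e'.
Proof.
move=> ee'; case: univ => cp sXt; have [_ cXt _] := sXt.
have cp' := covering_continuous cp.
have [f [cf pf fe]] := simply_connected_lift sXt cp cp' ee'.
have [g [cg pg ge]] := simply_connected_lift sXt cp cp' (esym ee').
have lift_id h k x : continuous h -> continuous k -> (forall y, p (h y) = p y) ->
    (forall y, p (k y) = p y) -> k (h x) = x -> cancel h k.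
  move=> ch ck ph pk hkx; apply: (unique_lift cp cXt (f := k \o h) (g := id)).
  - by move=> y; apply: continuous_comp; [exact: ch|exact: ck].
  - by move=> y; exact: cvg_id.
  - by move=> y /=; rewrite pk.
  - by exists x.
have fK : cancel f g by apply: (lift_id _ _ e); rewrite // fe ge.
have gK : cancel g f by apply: (lift_id _ _ e'); rewrite // ge fe.
by exists (Deck fK gK cf cg pf).
Qed.

End Deck.

Section OrbitSpaces.
Context (X Xt : topologicalType) (p : Xt -> X) (G : groupType).
Hypothesis univ : universal_covering p.

Local Notation XtG := (Xt * discrete_topology G)%type.

Context (a : left_action (deck p) XtG).

(** The actions [tau] and [sigma] have this form in common, so the geometry of
    their orbit spaces is treated once. *)
Definition deck_skew := exists b : deck p -> G -> G,
  forall f z, a f z = (f z.1, b f z.2).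

Hypothesis skew_a : deck_skew.

Lemma orbit_class_act f z : orbit_class a (a f z) = orbit_class a z.
Proof. by apply/esym/orbit_ofP; exists f. Qed.

Lemma orbit_class_proj z : orbit_proj (orbit_class a z) = p z.1.
Proof. by have [b aE] := skew_a; apply: orbit_projE => f z'; rewrite aE. Qed.

Lemma orbit_classW (q : orbit_space a) : exists xi (g : G), q = orbit_class a (xi, g).
Proof. by have [[xi g] qE] := orbit_ofW q; exists xi, g. Qed.

(** Together with [orbit_class_inj]: a point [xi] of the universal covering
    identifies [G] with the fibre of the orbit space over [p xi], since deck
    transformations act simply transitively on the fibres of [p]. *)
Lemma orbit_class_surj (q : orbit_space a) xi : orbit_proj q = p xi ->
  exists g : G, q = orbit_class a (xi, g).
Proof.
have [b aE] := skew_a; have [xi' [g ->]] := orbit_classW q; rewrite orbit_class_proj => pp.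
have [f fxi] := deck_transitive univ pp.
by exists (b f g); rewrite -(orbit_class_act f) aE /= fxi.
Qed.

Lemma orbit_class_inj xi (g g' : G) :
  orbit_class a (xi, g) = orbit_class a (xi, g') -> g = g'.
Proof.
have [b aE] := skew_a; move=> /orbit_ofP[f]; rewrite aE => -[fxi bg].
have f1 : f = 1 by apply: (deck_free univ (xi := xi)); rewrite -fxi.
by have := lact1 a (xi, g); rewrite -f1 aE /= -bg => -[].
Qed.

(** For fixed [g] the map sending [v] to the class of [(v, g)] is continuous
    and open.  This describes the quotient topology completely, and all
    topological statements about orbit spaces below go through it. *)
Lemma nbhs_orbit_class xi (g : G) (W : set (orbit_space a)) :
  nbhs (orbit_class a (xi, g)) W <-> nbhs xi [set v | W (orbit_class a (v, g))].
Proof.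
split=> [Wg|].
  have cpi : continuous (orbit_class a) by exact: pi_continuous.
  by have /nbhs_prod_discrete := continuous_nbhs cpi Wg.
rewrite nbhsE => -[V [oV Vxi] VW].
(* The saturation of the slice over [V] is a union of translates of slices. *)
pose O := orbit_class a @` [set z | V z.1 /\ z.2 = g].
have oO : open O.
  have [b aE] := skew_a.
  have : open (orbit_class a @^-1` O).
    rewrite openE => -[y d] [[v _] /= [Vv ->] /esym vy].
    have /orbit_ofP[f] := esym vy; rewrite aE => -[yE dE].
    apply/nbhs_prod_discrete => /=.
    have : nbhs y (deck_inv f @^-1` V).
      apply: continuous_nbhs; first exact: deck_inv_continuous.
      by rewrite yE deck_funK; exact: open_nbhsW.
    apply: filterS => t Vt; exists (deck_inv f t, g) => //.
    by rewrite -(orbit_class_act f) aE /= deck_invK dE.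
  by [].
have Oxi : O (orbit_class a (xi, g)) by exists (xi, g).
by apply: filterS (open_nbhsW oO Oxi) => _ [[v d] [/= Vv ->] <-]; exact: VW.
Qed.

Lemma orbit_factorE (Y : Type) (F : XtG -> Y) :
  (forall f z, F (a f z) = F z) -> forall z, F (repr (orbit_class a z)) = F z.
Proof.
move=> Fa z; have /orbit_ofP[f ->] :
    orbit_class a z = orbit_class a (repr (orbit_class a z)).
  by apply/esym; exact: reprK.
exact: Fa.
Qed.

Lemma orbit_space_continuous (Y : topologicalType) (F : orbit_space a -> Y) :
  (forall g : G, continuous (fun xi => F (orbit_class a (xi, g)))) -> continuous F.
Proof.
move=> cF q; have [xi [g ->]] := orbit_classW q => W WF.
by apply/nbhs_orbit_class; exact: continuous_nbhs (cF g) WF.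
Qed.

Lemma orbit_class_continuous (g : G) : continuous (fun xi => orbit_class a (xi, g)).
Proof. by move=> xi W /nbhs_orbit_class. Qed.

End OrbitSpaces.

(** * Torsors associated with crossed morphisms *)

Section Classification.
Context (X Xt : topologicalType) (p : Xt -> X) (Z : fibre_magma X) (G : groupType).
Context (phi : {multiplicative deck p -> gaut G}) (Theta : quot_group phi -> Z).
Hypotheses (connX : connected [set: X]) (univ : universal_covering p).
Hypotheses (covZ : group_covering Z) (isoTheta : group_covering_iso Theta).

(** Coordinates on the group covering: each point [xi] of the universal
    covering identifies [G] with the fibre over [p xi]. *)
Definition frame (xi : Xt) (g : G) : Z := Theta (orbit_class (tau phi) (xi, g)).

Lemma tau_skew : deck_skew (tau phi).
Proof. by exists (fun f g => phi f g). Qed.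

Lemma sigma_skew rho : deck_skew (sigma rho (phi := phi)).
Proof. by exists (fun f g => rho f * phi f g). Qed.

Lemma frame_act (f : deck p) xi g : frame (f xi) (phi f g) = frame xi g.
Proof. by rewrite /frame; congr Theta; exact: (orbit_class_act (tau phi) f (xi, g)). Qed.

Lemma frame_proj xi g : sp_proj (frame xi g) = p xi.
Proof.
have [_ pT _] := isoTheta.
by rewrite /frame pT; exact: (orbit_class_proj tau_skew (xi, g)).
Qed.

Lemma frame_mul xi g d : sp_mul (frame xi g) (frame xi d) = frame xi (g * d).
Proof.
have [_ pT mT] := isoTheta.
rewrite /frame -mT; first by rewrite /= quot_mulE.
by rewrite -!pT [LHS]frame_proj [RHS]frame_proj.
Qed.

Lemma frame_inj xi g d : frame xi g = frame xi d -> g = d.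
Proof.
have [[_ [k [_ Tk _]]] _ _] := isoTheta.
by rewrite /frame => /(can_inj Tk); exact: (orbit_class_inj univ tau_skew).
Qed.

Lemma frame_surj xi z : sp_proj z = p xi -> exists g, z = frame xi g.
Proof.
have [[_ [k [_ Tk kT]]] pT _] := isoTheta.
rewrite -(kT z) pT => /(orbit_class_surj univ tau_skew)[g ->].
by exists g.
Qed.

Lemma nbhs_frame xi g (W : set Z) :
  nbhs (frame xi g) W <-> nbhs xi [set v | W (frame v g)].
Proof.
have [homT _ _] := isoTheta; have cT := homT.1.
split=> [|nW]; first by move=> /(continuous_nbhs cT)/(nbhs_orbit_class tau_skew).
have /(homeomorphism_open_map homT) : nbhs (orbit_class (tau phi) (xi, g))
    [set q | W (Theta q)] by apply/(nbhs_orbit_class tau_skew).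
by apply: filterS => _ [q Wq <-].
Qed.

Lemma frame_unit xi g : fibre_unit (frame xi g) -> g = 1.
Proof.
move=> /(_ (frame xi g) erefl)[+ _]; rewrite frame_mul => /frame_inj.
by rewrite -{3}[g]mulg1 => /mulgI.
Qed.

Lemma frame_continuous g : continuous (frame^~ g).
Proof. by move=> xi W /nbhs_frame. Qed.

Section AssociatedTorsor.
Context (rho : crossed phi).

Definition quot_point xi g : orbit_space (sigma rho) :=
  orbit_class (sigma rho) (xi, g).

Local Notation pt := quot_point.

Lemma quot_proj xi g : orbit_proj (pt xi g) = p xi.
Proof. exact: (orbit_class_proj (sigma_skew rho) (xi, g)). Qed.

Lemma quot_act_frame xi g d : quot_act Theta (pt xi g) (frame xi d) = pt xi (g * d).
Proof. exact: quot_actE. Qed.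

Lemma universal_surjective x : exists xi, p xi = x.
Proof.
have [cp [[xi0 _] _ _]] := univ.
exact: covering_surjective cp connX xi0 x.
Qed.

Lemma same_fibre_frame (q : orbit_space (sigma rho)) (z : Z) :
  orbit_proj q = sp_proj z ->
  exists xi g d, q = pt xi g /\ z = frame xi d.
Proof.
have [xi [g ->]] := orbit_classW q; rewrite quot_proj => pz.
by have [d ->] := frame_surj (esym pz); exists xi, g, d.
Qed.

(** On a neighbourhood [V] of [xi] on which [p] is injective, two points with
    coordinates [(v, g)] and [(w, d)] over the same base point have [v = w],
    and then their product has coordinates [(v, g * d)]. *)
Lemma quot_act_continuous :
  {within [set ea : orbit_space (sigma rho) * Z | orbit_proj ea.1 = sp_proj ea.2],
    continuous (fun ea => quot_act Theta ea.1 ea.2)}.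
Proof.
apply/subspace_continuousP => -[q z] /= /same_fibre_frame[xi [g [d [-> ->]]]] W.
rewrite /from_subspace /= quot_act_frame => /(nbhs_orbit_class (sigma_skew rho)) nW.
have [V [oV Vxi] Vinj] := covering_nbhs_inj xi univ.1.
have nV : nbhs xi (V `&` [set v | W (pt v (g * d))]).
  by apply: filterI nW; exact: open_nbhsW.
pose V' := V `&` [set v | W (pt v (g * d))].
have nq : nbhs (pt xi g) (pt^~ g @` V').
  by apply/(nbhs_orbit_class (sigma_skew rho)); apply: filterS nV => v; exists v.
have nz : nbhs (frame xi d) (frame^~ d @` V').
  by apply/nbhs_frame; apply: filterS nV => v; exists v.
exists (pt^~ g @` V', frame^~ d @` V') => // -[_ _] /= [[v [Vv Wv] <-] [w [Vw _] <-]].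
rewrite quot_proj frame_proj => /(Vinj _ _ Vv Vw) <-.
by rewrite quot_act_frame.
Qed.

(** Over the image of a sheet [V] of [p], both spaces have unique coordinates
    [(v, g)] with [v] in [V]; match them. *)
Lemma quot_torsor_locally_trivial x : exists2 U, open_nbhs x U &
  exists h : @sp_proj X Z @^-1` U -> @ts_proj X Z (quot_torsor Theta rho) @^-1` U,
  [/\ homeomorphism h,
      forall a, ts_proj (set_val (h a)) = sp_proj (set_val a)
    & forall (a c : @sp_proj X Z @^-1` U) (b : Z),
        sp_proj (set_val a) = sp_proj b ->
        set_val c = sp_mul (set_val a) b ->
        set_val (h c) = ts_act (set_val (h a)) b].
Proof.
have [xi0 pxi0] := universal_surjective x.
have [V [oV Vxi0] Vinj] := covering_nbhs_inj xi0 univ.1.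
exists (p @` V).
  split; last by exists xi0.
  by apply: open_map_open => //; exact: (covering_open_map univ.1).
(* The local section of [p] with values in [V]; outside [p @` V] the default
   values are irrelevant, as only the restriction to [p @` V] is used. *)
pose s y := xget xi0 [set v | V v /\ p v = y].
have sE v : V v -> s (p v) = v.
  by move=> Vv; apply: xget_unique => // w [Vw pw]; exact: Vinj.
pose f z := pt (s (sp_proj z)) (xget 1 [set d | z = frame (s (sp_proj z)) d]).
pose g q := frame (s (orbit_proj q)) (xget 1 [set d | q = pt (s (orbit_proj q)) d]).
have fE v d : V v -> f (frame v d) = pt v d.
  move=> Vv; rewrite /f frame_proj sE //; congr (pt v _).
  by apply: xget_unique => // d' /= /frame_inj.
have gE v d : V v -> g (pt v d) = frame v d.
  move=> Vv; rewrite /g quot_proj sE //; congr (frame v _).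
  by apply: xget_unique => // d' /= /(orbit_class_inj univ (sigma_skew rho)).
have zE z : (p @` V) (sp_proj z) -> exists v d, V v /\ z = frame v d.
  by move=> [v Vv /esym /frame_surj[d zE]]; exists v, d.
have qE q : (p @` V) (orbit_proj q) -> exists v d, V v /\ q = pt v d.
  move=> [v Vv /esym /(orbit_class_surj univ (sigma_skew rho))[d qE]].
  by exists v, d.
have [||h hh hE] := @homeomorphism_restrict _ _ (@sp_proj X Z @^-1` (p @` V))
    (@ts_proj X Z (quot_torsor Theta rho) @^-1` (p @` V)) f g.
- move=> z /zE[v [d [Vv ->]]]; rewrite fE // gE //; split=> //.
    by rewrite /= quot_proj; exists v.
  move=> W; rewrite fE // => /(nbhs_orbit_class (sigma_skew rho)) nW.
  apply/nbhs_frame; apply: filterS2 nW (open_nbhsW oV Vv) => w Ww Vw.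
  by rewrite /= fE.
- move=> q /qE[v [d [Vv ->]]]; rewrite gE // fE //; split=> //.
    by rewrite /= frame_proj; exists v.
  move=> W; rewrite gE // => /nbhs_frame nW.
  apply/(nbhs_orbit_class (sigma_skew rho)).
  apply: filterS2 nW (open_nbhsW oV Vv) => w Ww Vw.
  by rewrite /= gE.
exists h; split=> //.
  move=> a; rewrite hE; have [v [d [Vv ->]]] := zE (set_val a) (set_valP a).
  by rewrite fE //= quot_proj frame_proj.
move=> a c b; rewrite !hE => + ->.
have [v [d [Vv ->]]] := zE (set_val a) (set_valP a).
rewrite frame_proj => /esym /frame_surj[e ->].
by rewrite frame_mul !fE //= quot_act_frame.
Qed.

Lemma quot_torsorP : is_torsor (quot_torsor Theta rho).
Proof.
split.
- apply: (orbit_space_continuous (sigma_skew rho)) => g xi W.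
  rewrite /= quot_proj => /(continuous_nbhs (covering_continuous univ.1)).
  apply: filterS => v.
  by rewrite /= quot_proj.
- exact: quot_act_continuous.
- move=> q z /same_fibre_frame[xi [g [d [-> ->]]]] /=.
  by rewrite quot_act_frame !quot_proj.
- split=> [q z|q z z'] /same_fibre_frame[xi [g [d [-> ->]]]].
    by move=> /frame_unit ->; rewrite /= quot_act_frame mulg1.
  rewrite frame_proj => /esym /frame_surj[d' ->].
  by rewrite frame_mul /= !quot_act_frame mulgA.
- exact: quot_torsor_locally_trivial.
Qed.

End AssociatedTorsor.

(** * Twisted sections and the classification *)

Lemma univ_connected : connected [set: Xt].
Proof. by have [_ []] := univ. Qed.

(** A section of the pullback of [E] to the universal covering, together with
    the cocycle that measures its failure to descend to [X]. *)
Definition twisted_section (E : fibre_act Z) (rho : deck p -> G) (s : Xt -> E) :=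
  [/\ continuous s,
      forall xi, ts_proj (s xi) = p xi
    & forall (f : deck p) xi, ts_act (s (f xi)) (frame (f xi) (rho f)) = s xi].

(** The morphism sends the class of [(xi, g)] to the translate of [s xi] by
    the element of the group covering with coordinates [(xi, g)]; the twisting
    condition says exactly that this is invariant under [sigma rho]. *)
Lemma twisted_section_isomorphic (E : fibre_act Z) (rho : crossed phi) s :
  is_torsor E -> twisted_section (E := E) rho s ->
  torsor_isomorphic (quot_torsor Theta rho) E.
Proof.
move=> torE [cs ps sE].
pose F (z : Xt * discrete_topology G) := ts_act (s z.1) (frame z.1 z.2).
have Fsigma f z : F (sigma rho f z) = F z.
  rewrite /F /= -frame_mul (torsor_actM torE) ?frame_proj ?ps //.
  by rewrite sE frame_act.
pose H (q : quot_torsor Theta rho) : E := F (repr (q : orbit_space (sigma rho))).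
suff homH : torsor_hom H.
  exact: (torsor_hom_isomorphic covZ (quot_torsorP rho) torE homH).
have HE xi g : H (orbit_class (sigma rho) (xi, g)) = ts_act (s xi) (frame xi g).
  exact: (orbit_factorE Fsigma (xi, g)).
split.
- apply: (orbit_space_continuous (sigma_skew rho)) => g.
  rewrite (_ : (fun xi => _) = (fun xi => ts_act (s xi) (frame xi g))); last first.
    by apply/funext => xi; exact: HE.
  apply: (torsor_act_continuous torE cs) => [|xi]; first exact: frame_continuous.
  by rewrite ps frame_proj.
- move=> q; have [xi [g ->]] := orbit_classW q.
  by rewrite HE (torsor_act_proj torE) ?ps ?frame_proj //= quot_proj.
- move=> q z /same_fibre_frame[xi [g [d [-> ->]]]].
  rewrite /= quot_act_frame !HE -frame_mul (torsor_actM torE) //.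
    by rewrite ps frame_proj.
  by rewrite !frame_proj.
Qed.

(** The torsor is a covering of [X], so [p] lifts to it. *)
Lemma torsor_section (E : fibre_act Z) : is_torsor E ->
  exists s : Xt -> E, continuous s /\ forall xi, ts_proj (s xi) = p xi.
Proof.
move=> torE; have [cp sXt] := univ; have [[xi0 _] _ _] := sXt.
have [e0 pe0] := torsor_fibre_nonempty covZ torE (p xi0).
have [s [cs ps _]] := simply_connected_lift sXt (torsor_covering covZ torE)
  (covering_continuous cp) (esym pe0).
by exists s.
Qed.

Lemma torsor_sections_eq (E : fibre_act Z) (s t : Xt -> E) xi0 :
  is_torsor E -> continuous s -> continuous t ->
  (forall xi, ts_proj (s xi) = ts_proj (t xi)) -> s xi0 = t xi0 -> s =1 t.
Proof.
move=> torE cs ct st st0.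
by apply: (unique_lift (torsor_covering covZ torE) univ_connected) => //; exists xi0.
Qed.

(** Choose [rho f] so that the twisting condition holds at one point; both
    sides are lifts of [p] to the covering [E], so it holds everywhere.
    Applying it at two different points then yields the cocycle identity. *)
Lemma section_twisted (E : fibre_act Z) (s : Xt -> E) :
  is_torsor E -> continuous s -> (forall xi, ts_proj (s xi) = p xi) ->
  exists rho : crossed phi, twisted_section rho s.
Proof.
move=> torE cs ps; have [_ [[xi0 _] _ _]] := univ.
have rhoP (f : deck p) : exists g : G, ts_act (s (f xi0)) (frame (f xi0) g) = s xi0.
  have [|z pz zE] := torsor_divide covZ torE (e := s (f xi0)) (e' := s xi0).
    by rewrite !ps deck_over.
  have [|g gE] := @frame_surj (f xi0) z; first by rewrite -pz ps.
  by exists g; rewrite -gE.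
have [rho rhoE0] := choice rhoP.
have rhoE (f : deck p) xi : ts_act (s (f xi)) (frame (f xi) (rho f)) = s xi.
  apply: (torsor_sections_eq (xi0 := xi0) torE
    (s := fun xi => ts_act (s (f xi)) (frame (f xi) (rho f)))) => //; last first.
    by move=> xi'; rewrite (torsor_act_proj torE) ?frame_proj ?ps ?deck_over.
  apply: (torsor_act_continuous torE) => [||xi']; last by rewrite frame_proj ps.
    by move=> xi'; apply: continuous_comp; [exact: deck_fun_continuous|exact: cs].
  move=> xi'; apply: (continuous_comp (g := frame^~ (rho f))).
    exact: deck_fun_continuous.
  exact: frame_continuous.
have rhoM (f1 f2 : deck p) : rho (f1 * f2) = rho f1 * phi f1 (rho f2).
  apply: (frame_inj (xi := f1 (f2 xi0))).
  apply: (torsor_act_inj covZ torE (e := s (f1 (f2 xi0)))); rewrite ?ps ?frame_proj //.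
  rewrite (rhoE (f1 * f2)) -frame_mul (torsor_actM torE) ?frame_proj ?ps //.
  by rewrite rhoE frame_act rhoE.
by exists (Crossed rhoM).
Qed.

Lemma torsor_isomorphic_quot (E : fibre_act Z) : is_torsor E ->
  exists rho : crossed phi, torsor_isomorphic E (quot_torsor Theta rho).
Proof.
move=> torE; have [s [cs ps]] := torsor_section torE.
have [rho rs] := section_twisted torE cs ps.
by exists rho; apply: torsor_isomorphic_sym; exact: twisted_section_isomorphic rs.
Qed.

Lemma conj_actionP (rho rho' : crossed phi) g :
  rho' = conj_action phi g rho <-> forall f, rho' f * phi f g = g * rho f.
Proof.
split=> [-> f|E]; first by rewrite /= gautV mulgVK.
by apply: crossedP => f /=; rewrite -E gautV mulgK.
Qed.

(** An isomorphism maps the section of classes of [(xi, 1)] to a continuous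
    section over [p], which must be the section of classes of [(xi, g)] for
    the [g] found at one point.  Evaluating at [f xi] and at [xi] compares
    [rho] with [rho'].  Conversely, when [rho'] is the conjugate of [rho] by
    [g], the classes of [(xi, g)] form a section twisted by [rho]. *)
Lemma quot_torsor_isomorphicP (rho rho' : crossed phi) :
  torsor_isomorphic (quot_torsor Theta rho) (quot_torsor Theta rho') <->
  exists g : G, rho' = conj_action phi g rho.
Proof.
pose pt (r : crossed phi) xi g := orbit_class (sigma r) (xi, g).
have ptE (r : crossed phi) (f : deck p) xi g : pt r (f xi) (r f * phi f g) = pt r xi g.
  exact: (orbit_class_act (sigma r) f (xi, g)).
have ptc r g : continuous (fun xi => pt r xi g).
  exact: orbit_class_continuous (sigma_skew r) g.
split=> [[F [_ [[cF pF aF] _ _ _]]]|[g /conj_actionP gE]].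
  have [_ [[xi0 _] _ _]] := univ.
  have Fpt1 xi : orbit_proj (F (pt rho xi 1)) = p xi.
    by have := pF (pt rho xi 1); rewrite /= quot_proj.
  have [g gE0] := orbit_class_surj univ (sigma_skew rho') (Fpt1 xi0).
  have gE : forall xi, F (pt rho xi 1) = pt rho' xi g.
    apply: (torsor_sections_eq (xi0 := xi0) (quot_torsorP rho')
      (s := fun xi => F (pt rho xi 1)) (t := fun xi => pt rho' xi g)) => //.
    - by move=> xi; apply: continuous_comp; [exact: ptc|exact: cF].
    - exact: ptc.
    - by move=> xi; rewrite /= Fpt1 quot_proj.
  have Fpt xi d : F (pt rho xi d) = pt rho' xi (g * d).
    have := aF (pt rho xi 1) (frame xi d).
    rewrite /= quot_proj frame_proj => /(_ erefl).
    by rewrite quot_act_frame mul1g gE quot_act_frame.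
  exists g; apply/conj_actionP => f.
  apply: (orbit_class_inj univ (sigma_skew rho') (xi := f xi0)).
  rewrite -[RHS](Fpt (f xi0) (rho f)) [LHS](ptE rho' f xi0 g) -gE; congr F.
  by rewrite -(ptE rho f xi0 1) gaut1 mulg1.
apply: (@twisted_section_isomorphic (quot_torsor Theta rho') _
  (fun xi => pt rho' xi g) (quot_torsorP rho')).
split; first exact: ptc.
- by move=> xi; rewrite /= quot_proj.
- by move=> f xi; rewrite /= quot_act_frame -gE; exact: ptE.
Qed.

Lemma torsor_class_bijection : exists B : H1 phi -> iso_classes Z,
  bijective B /\
  forall rho (E : torsor Z),
    proj1_sig (B (orbit_of (conj_action phi) rho)) E <->
    torsor_isomorphic E (quot_torsor Theta rho).
Proof.
pose Q rho : torsor Z := Torsor (quot_torsorP rho).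
have ccP rho : exists E, iso_class (Q rho) = iso_class E by exists (Q rho).
(* The value at an orbit uses an arbitrary representative; [BE] shows that it
   does not depend on the choice. *)
pose B (q : H1 phi) : iso_classes Z := exist _ (iso_class (Q (repr q))) (ccP _).
have BE rho (E : torsor Z) : proj1_sig (B (orbit_of (conj_action phi) rho)) E <->
    torsor_isomorphic E (quot_torsor Theta rho).
  have /orbit_ofP/quot_torsor_isomorphicP rr : orbit_of (conj_action phi) rho =
      orbit_of (conj_action phi) (repr (orbit_of (conj_action phi) rho)).
    by apply/esym; exact: reprK.
  by split=> /torsor_isomorphic_trans; apply=> //; exact: torsor_isomorphic_sym.
have BP (C : iso_classes Z) : exists q, B q = C.
  case: C => C CP; case: (CP) => E CE.
  have [rho Erho] := torsor_isomorphic_quot (torsorP E).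
  exists (orbit_of (conj_action phi) rho); apply: eq_exist.
  rewrite CE; apply/funext => E'; apply/propext.
  apply: (iff_trans (BE rho E')); split=> /torsor_isomorphic_trans; apply=> //.
  exact: torsor_isomorphic_sym.
have Binj : injective B.
  move=> q r; have [rho ->] := orbit_ofW q; have [rho' ->] := orbit_ofW r.
  move=> /(congr1 (fun C => proj1_sig C (Q rho))) Bqr.
  apply/orbit_ofP/quot_torsor_isomorphicP/(BE rho' (Q rho)).
  by rewrite -Bqr; apply/BE; exact: torsor_isomorphic_refl.
have [B' B'K] := choice BP.
by exists B; split=> //; exists B' => // q; apply: Binj; rewrite B'K.
Qed.

End Classification.

Local Close Scope group_scope.
Unset Implicit Arguments.
Set Strict Implicit.

Theorem theorem4p3 (X Xt : topologicalType) (p : Xt -> X)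
    (Z : fibre_magma X) (G : groupType)
    (phi : {multiplicative deck p -> gaut G}) (Theta : quot_group phi -> Z)
    (connX : connected [set: X])
    (univ : universal_covering p)
    (covZ : group_covering Z)
    (isoTheta : group_covering_iso Theta) :
  [/\ forall rho : crossed phi, is_torsor (quot_torsor Theta rho),
      forall E : torsor Z, exists rho : crossed phi,
        torsor_isomorphic E (quot_torsor Theta rho),
      forall rho rho' : crossed phi,
        torsor_isomorphic (quot_torsor Theta rho) (quot_torsor Theta rho') <->
        exists g : G, rho' = conj_action phi g rho
    & exists B : H1 phi -> iso_classes Z,
        bijective B /\
        forall rho (E : torsor Z),
          proj1_sig (B (orbit_of (conj_action phi) rho)) E <->
          torsor_isomorphic E (quot_torsor Theta rho)].
Proof.
split=> [rho|E|rho rho'|].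
- exact: quot_torsorP.
- exact: torsor_isomorphic_quot (torsorP E).
- exact: quot_torsor_isomorphicP.
- exact: torsor_class_bijection.
Qed.
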